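(* Let $\mathbf{A}$ be the Brouwerian algebra whose lattice order is as follows: its universe consists of distinct elements $\top$ and $b_i,c_i,d_i$ ($i\in\omega$), ordered by the reflexive transitive closure of the relations $d_0<\top$ and, for every $i\in\omega$, $b_i<d_i$, $c_i<d_i$, $d_{i+1}<b_i$ and $d_{i+1}<c_i$ (so $b_i$ and $c_i$ are incomparable, $b_i\vee c_i=d_i$ and $b_i\wedge c_i=d_{i+1}=b_{i+1}\vee c_{i+1}$). Let $\mathbf{A}_\bot$ be the Heyting algebra obtained by adding a new least element $\bot$ to the lattice reduct of $\mathbf{A}$. Then the ES property fails in the variety $\mathbb{V}(\mathbf{A})$ of Brouwerian algebras and in the variety $\mathbb{V}(\mathbf{A}_\bot)$ of Heyting algebras.
   Context: A Brouwerian algebra is an algebra $\langle A;\to,\wedge,\vee,\top\rangle$ whose $\wedge,\vee$ reduct is a lattice with greatest element $\top$ and in which $x\wedge y\leqslant z\iff x\leqslant y\to z$; it is determined by its lattice reduct. A Heyting algebra is a Brouwerian algebra with a distinguished least element $\bot$. $\mathbb{V}(\mathbf{B})$ denotes the variety generated by an algebra $\mathbf{B}$. A class $\mathsf{K}$ of similar algebras is regarded as a category whose morphisms are all algebraic homomorphisms between members of $\mathsf{K}$. A $\mathsf{K}$-morphism $h\colon A\to B$ is a $\mathsf{K}$-epimorphism if, for all $\mathsf{K}$-morphisms $f,g$ from $B$ to a single member of $\mathsf{K}$, $f\circ h=g\circ h$ implies $f=g$. $\mathsf{K}$ has the ES property if every $\mathsf{K}$-epimorphism is surjective. *)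

(* Defs.v *)
From Stdlib Require Import Relation_Operators.
From mathcomp Require Import all_boot zify.

Set Implicit Arguments.
Unset Strict Implicit.
Unset Printing Implicit Defensive.

Record signature := Signature { op : Type; arity : op -> nat }.

Record algebra (S : signature) := Algebra {
  carrier :> Type;
  interp : forall f : op S, ('I_(arity f) -> carrier) -> carrier
}.

Definition is_hom (S : signature) (A B : algebra S) (h : A -> B) : Prop :=
  forall (f : op S) (v : 'I_(arity f) -> A), h (interp v) = interp (h \o v).

Definition surjective (A B : Type) (h : A -> B) : Prop :=
  forall y, exists x, h x = y.

Definition is_subuniverse (S : signature) (A : algebra S) (P : A -> Prop) :=
  forall (f : op S) (v : 'I_(arity f) -> A),
    (forall i, P (v i)) -> P (interp v).

Definition subalgebra (S : signature) (A : algebra S) (P : A -> Prop)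
    (clP : is_subuniverse P) : algebra S :=
  @Algebra S {x : A | P x} (fun f v =>
    exist P (interp (fun i => proj1_sig (v i)))
            (clP f _ (fun i => proj2_sig (v i)))).

Definition product (S : signature) (I : Type) (A : I -> algebra S) :
    algebra S :=
  @Algebra S (forall j, A j) (fun f v j => interp (fun i => v i j)).

Record is_variety (S : signature) (K : algebra S -> Prop) : Prop := {
  variety_H : forall (A B : algebra S) (h : A -> B),
    K A -> is_hom h -> surjective h -> K B;
  variety_S : forall (A : algebra S) (P : A -> Prop) (clP : is_subuniverse P),
    K A -> K (subalgebra clP);
  variety_P : forall (I : Type) (A : I -> algebra S),
    (forall j, K (A j)) -> K (product A)
}.

Definition variety_gen (S : signature) (B : algebra S) (A : algebra S) : Prop :=
  forall K : algebra S -> Prop, is_variety K -> K B -> K A.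

Definition is_epi (S : signature) (K : algebra S -> Prop) (A B : algebra S)
    (h : A -> B) : Prop :=
  forall (C : algebra S) (f g : B -> C),
    K C -> is_hom f -> is_hom g -> f \o h =1 g \o h -> f =1 g.

Definition ES_property (S : signature) (K : algebra S -> Prop) : Prop :=
  forall (A B : algebra S) (h : A -> B),
    K A -> K B -> is_hom h -> is_epi K h -> surjective h.

Record brouwerian := Brouwerian {
  br_sort :> Type;
  br_le : br_sort -> br_sort -> Prop;
  br_imp : br_sort -> br_sort -> br_sort;
  br_meet : br_sort -> br_sort -> br_sort;
  br_join : br_sort -> br_sort -> br_sort;
  br_top : br_sort;
  br_le_refl : forall x, br_le x x;
  br_le_anti : forall x y, br_le x y -> br_le y x -> x = y;
  br_le_trans : forall x y z, br_le x y -> br_le y z -> br_le x z;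
  br_meetP : forall x y z, br_le z (br_meet x y) <-> br_le z x /\ br_le z y;
  br_joinP : forall x y z, br_le (br_join x y) z <-> br_le x z /\ br_le y z;
  br_topP : forall x, br_le x br_top;
  br_impP : forall x y z, br_le (br_meet x y) z <-> br_le x (br_imp y z)
}.

Record heyting := Heyting {
  ha_br :> brouwerian;
  ha_bot : ha_br;
  ha_botP : forall x, br_le ha_bot x
}.

Inductive br_op := Imp | Meet | Join | Top.

Definition br_arity (f : br_op) : nat := if f is Top then 0 else 2.

Definition br_sig : signature := Signature br_arity.

Definition br_interp (A : brouwerian) (f : br_op) :
    ('I_(br_arity f) -> A) -> A :=
  match f with
  | Imp => fun v => br_imp (v ord0) (v ord_max)
  | Meet => fun v => br_meet (v ord0) (v ord_max)
  | Join => fun v => br_join (v ord0) (v ord_max)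
  | Top => fun _ => br_top A
  end.

Definition br_alg (A : brouwerian) : algebra br_sig :=
  @Algebra br_sig A (@br_interp A).

(* [None] is the symbol for the least element. *)
Definition ha_arity (f : option br_op) : nat := oapp br_arity 0 f.

Definition ha_sig : signature := Signature ha_arity.

Definition ha_interp (A : heyting) (f : option br_op) :
    ('I_(ha_arity f) -> A) -> A :=
  match f with
  | Some f' => @br_interp A f'
  | None => fun _ => ha_bot A
  end.

Definition ha_alg (A : heyting) : algebra ha_sig :=
  @Algebra ha_sig A (@ha_interp A).

Section AddBot.
Variable A : brouwerian.
Implicit Types x y z : option A.

Definition ab_le x y : Prop :=
  match x, y with
  | None, _ => True
  | Some _, None => False
  | Some a, Some b => br_le a b
  end.

Definition ab_imp x y : option A :=
  match x, y with
  | None, _ => Some (br_top A)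
  | Some _, None => None
  | Some a, Some b => Some (br_imp a b)
  end.

Definition ab_meet x y : option A :=
  match x, y with
  | Some a, Some b => Some (br_meet a b)
  | _, _ => None
  end.

Definition ab_join x y : option A :=
  match x, y with
  | None, _ => y
  | _, None => x
  | Some a, Some b => Some (br_join a b)
  end.

Fact ab_le_refl x : ab_le x x.
Proof. by case: x => //= a; apply: br_le_refl. Qed.

Fact ab_le_anti x y : ab_le x y -> ab_le y x -> x = y.
Proof. by case: x y => [a|] [b|] //= ab ba; rewrite (br_le_anti ab ba). Qed.

Fact ab_le_trans x y z : ab_le x y -> ab_le y z -> ab_le x z.
Proof. by case: x y z => [a|] [b|] [c|] //=; apply: br_le_trans. Qed.

Fact ab_meetP x y z : ab_le z (ab_meet x y) <-> ab_le z x /\ ab_le z y.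
Proof. by case: x y z => [a|] [b|] [c|] //=; try tauto; apply: br_meetP. Qed.

Fact ab_joinP x y z : ab_le (ab_join x y) z <-> ab_le x z /\ ab_le y z.
Proof. by case: x y z => [a|] [b|] [c|] //=; try tauto; apply: br_joinP. Qed.

Fact ab_topP x : ab_le x (Some (br_top A)).
Proof. by case: x => //= a; apply: br_topP. Qed.

Fact ab_impP x y z : ab_le (ab_meet x y) z <-> ab_le x (ab_imp y z).
Proof.
case: x y z => [a|] [b|] [c|] //=; first exact: br_impP.
  by split=> // _; apply: br_topP.
by split=> // _; apply: br_topP.
Qed.

Definition add_bot_br : brouwerian :=
  Brouwerian ab_le_refl ab_le_anti ab_le_trans ab_meetP ab_joinP ab_topP
             ab_impP.

Fact ab_botP (x : add_bot_br) : br_le (None : add_bot_br) x.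
Proof. by []. Qed.

Definition add_bot : heyting := Heyting ab_botP.

End AddBot.

Inductive elt := top_ | b_ of nat | c_ of nat | d_ of nat.

Inductive elt_lt : elt -> elt -> Prop :=
| lt_d0_top : elt_lt (d_ 0) top_
| lt_b_d i : elt_lt (b_ i) (d_ i)
| lt_c_d i : elt_lt (c_ i) (d_ i)
| lt_d_b i : elt_lt (d_ i.+1) (b_ i)
| lt_d_c i : elt_lt (d_ i.+1) (c_ i).

Definition elt_le : elt -> elt -> Prop := clos_refl_trans elt elt_lt.

(* A decision procedure for [elt_le], see [elt_leP]: [depth x] is the length of
   the maximal chains from [x] up to [top_], and two distinct elements are
   comparable unless they have the same depth. *)
Definition depth (x : elt) : nat :=
  match x with
  | top_ => 0
  | d_ i => i.*2.+1
  | b_ i | c_ i => i.*2.+2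
  end.

Definition elt_leb (x y : elt) : bool :=
  (depth y < depth x) ||
  match x, y with
  | top_, top_ => true
  | b_ i, b_ j | c_ i, c_ j | d_ i, d_ j => i == j
  | _, _ => false
  end.

Definition elt_meet (x y : elt) : elt :=
  if elt_leb x y then x else if elt_leb y x then y else
  match x with b_ i | c_ i => d_ i.+1 | _ => x end.

Definition elt_join (x y : elt) : elt :=
  if elt_leb x y then y else if elt_leb y x then x else
  match x with b_ i | c_ i => d_ i | _ => x end.

Definition elt_imp (x y : elt) : elt :=
  if elt_leb x y then top_ else
  match x, y with
  | b_ i, d_ j => if j == i.+1 then c_ i else y
  | c_ i, d_ j => if j == i.+1 then b_ i else y
  | _, _ => y
  end.

Fact elt_leb_refl x : elt_leb x x.
Proof. by case: x => *; rewrite /elt_leb /=; lia. Qed.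

Fact elt_leb_anti x y : elt_leb x y -> elt_leb y x -> x = y.
Proof.
by case: x y => [|i|i|i] [|j|j|j]; rewrite /elt_leb //=; try lia;
  move=> *; congr (_ _); lia.
Qed.

Fact elt_leb_trans x y z : elt_leb x y -> elt_leb y z -> elt_leb x z.
Proof.
by case: x y z => [|i|i|i] [|j|j|j] [|k|k|k]; rewrite /elt_leb //=; lia.
Qed.

Fact elt_le_down x : elt_le x top_ /\ forall n, elt_leb x (d_ n) -> elt_le x (d_ n).
Proof.
have dd n : elt_le (d_ n.+1) (d_ n).
  by apply: (rt_trans _ _ _ (b_ n)); apply: rt_step; constructor.
have dn i n : n <= i -> elt_le (d_ i) (d_ n).
  elim: i => [|i IHi]; first by rewrite leqn0 => /eqP->; apply: rt_refl.
  rewrite leq_eqVlt ltnS => /orP[/eqP->|/IHi]; first exact: rt_refl.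
  exact: rt_trans (dd i).
have d0 : elt_le (d_ 0) top_ by apply: rt_step; constructor.
have bd i : elt_le (b_ i) (d_ i) by apply: rt_step; constructor.
have cd i : elt_le (c_ i) (d_ i) by apply: rt_step; constructor.
case: x => [|i|i|i]; split=> [|n]; rewrite /elt_leb //=.
- exact: rt_refl.
- exact: rt_trans (bd i) (rt_trans _ _ _ _ _ (dn i 0 isT) d0).
- by move=> ?; apply: rt_trans (bd i) (dn _ _ _); lia.
- exact: rt_trans (cd i) (rt_trans _ _ _ _ _ (dn i 0 isT) d0).
- by move=> ?; apply: rt_trans (cd i) (dn _ _ _); lia.
- exact: rt_trans (dn i 0 isT) d0.
- by move=> ?; apply: dn; lia.
Qed.

Fact elt_leP x y : elt_le x y <-> elt_leb x y.
Proof.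
split.
  elim=> {x y} [x y []|x|x y z _ xy _ yz] *; rewrite /elt_leb /=; try lia.
    exact: elt_leb_refl.
  exact: elt_leb_trans xy yz.
have [xtop xd] := elt_le_down x.
case: y => [//|j|j|j]; last exact: xd.
- case: x xtop xd => [|i|i|i] _ xd; rewrite /elt_leb //= => lexy.
  + have [<-|ij] := eqVneq i j; first exact: rt_refl.
    apply: (rt_trans _ _ _ (d_ j.+1)); last by apply: rt_step; constructor.
    by apply: xd; rewrite /elt_leb /=; lia.
  + apply: (rt_trans _ _ _ (d_ j.+1)); last by apply: rt_step; constructor.
    by apply: xd; rewrite /elt_leb /=; lia.
  + apply: (rt_trans _ _ _ (d_ j.+1)); last by apply: rt_step; constructor.
    by apply: xd; rewrite /elt_leb /=; lia.
- case: x xtop xd => [|i|i|i] _ xd; rewrite /elt_leb //= => lexy.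
  + apply: (rt_trans _ _ _ (d_ j.+1)); last by apply: rt_step; constructor.
    by apply: xd; rewrite /elt_leb /=; lia.
  + have [<-|ij] := eqVneq i j; first exact: rt_refl.
    apply: (rt_trans _ _ _ (d_ j.+1)); last by apply: rt_step; constructor.
    by apply: xd; rewrite /elt_leb /=; lia.
  + apply: (rt_trans _ _ _ (d_ j.+1)); last by apply: rt_step; constructor.
    by apply: xd; rewrite /elt_leb /=; lia.
Qed.

Fact elt_le_refl x : elt_le x x.
Proof. exact: rt_refl. Qed.

Fact elt_le_anti x y : elt_le x y -> elt_le y x -> x = y.
Proof. by move=> /elt_leP xy /elt_leP; apply: elt_leb_anti. Qed.

Fact elt_le_trans x y z : elt_le x y -> elt_le y z -> elt_le x z.
Proof. exact: rt_trans. Qed.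

Fact elt_meetP x y z : elt_le z (elt_meet x y) <-> elt_le z x /\ elt_le z y.
Proof.
rewrite !elt_leP /elt_meet.
case: x y z => [|i|i|i] [|j|j|j] [|k|k|k]; rewrite /elt_leb /=;
  do ?[case: ifP => /=]; lia.
Qed.

Fact elt_joinP x y z : elt_le (elt_join x y) z <-> elt_le x z /\ elt_le y z.
Proof.
rewrite !elt_leP /elt_join.
case: x y z => [|i|i|i] [|j|j|j] [|k|k|k]; rewrite /elt_leb /=;
  do ?[case: ifP => /=]; lia.
Qed.

Fact elt_topP x : elt_le x top_.
Proof. by have [] := elt_le_down x. Qed.

Fact elt_impP x y z : elt_le (elt_meet x y) z <-> elt_le x (elt_imp y z).
Proof.
rewrite !elt_leP /elt_meet /elt_imp.
case: x y z => [|i|i|i] [|j|j|j] [|k|k|k]; rewrite /elt_leb /=;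
  do ?[case: ifP => /=]; lia.
Qed.

Definition diamonds : brouwerian :=
  Brouwerian elt_le_refl elt_le_anti elt_le_trans elt_meetP elt_joinP elt_topP
             elt_impP.

(* Main.v *)
Require Import Defs.
From Stdlib Require Import Classical FunctionalExtensionality.
From Stdlib Require Import IndefiniteDescription.
From mathcomp Require Import all_boot zify.

Set Implicit Arguments.
Unset Strict Implicit.
Unset Printing Implicit Defensive.

(** The chain [C = {top_} u {b_ i}] is a proper subalgebra of [diamonds], because
    [b_ i -> b_ j] is [top_] or [b_ j].  Its inclusion is an epimorphism of the
    generated variety: two homomorphisms [f], [g] from [diamonds] into a member
    of the variety that agree on every [b_ i] agree on every [c_ i], and then on
    [d_ i], the join of [b_ i] and [c_ i].  The Heyting algebra is treated in
    the same way with [C] together with the least element.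

    That [f (c_ i) = g (c_ i)] comes from an identity of [diamonds] that involves
    only the three levels [i], [i + 1], [i + 2].  The elements [b_ i], [c_ i]
    satisfy, and their images inherit,
      [((b_ i -> c_ i) -> c_ i) /\ ((c_ i -> b_ i) -> b_ i) = top_]  and
      [b_ i /\ c_ i = b_ i.+1 \/ c_ i.+1].
    Let [b0, b1, b2] be elements for which both [c0, c1, c2] and [c0', c1', c2']
    satisfy these equations, in an algebra with greatest element [e] where an
    element is incomparable with at most one other.  By the first equation, [b]
    and [c] at each level are incomparable or one of them is [e].  So [c0] and
    [c0'] could differ only if one of them is incomparable with [b0] while the
    other is [e], or if [b0 = e].  In the former case the second equation says
    both that [b1 \/ c1] is strictly below [b0] and that [b1 \/ c1'] equals [b0];
    but the former forces [c1] to be the one element incomparable with [b1], and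
    then [c1'] has to be [e] or [c1], and neither fits
    ([no_mixed_levels]).  In the latter case [c0 = b1 \/ c1] and
    [c0' = b1 \/ c1'], and the same reasoning applies one level down
    ([partner_unique2]).

    To turn this implication into an identity, the conjunction of the premises
    is used as a parameter: below an arbitrary element [e] a Brouwerian algebra
    is again one, with greatest element [e] and operations truncated by [e].
    Taking for [e] the meet of all the terms in the premises gives
    [e /\ c0 = e /\ c0'] ([three_levels_identity]).  As identities pass to
    generated varieties ([natural_op_eq_variety_gen]), this determines [f (c_ i)]
    ([homs_from_diamonds_eq]). *)

(** * Identities and generated varieties *)

(** Families of operations that commute with all homomorphisms play the part of
    terms, because the preservation of identities uses nothing else of terms. *)
Definition natural_op (S : signature) (X : Type)
    (t : forall D : algebra S, (X -> D) -> D) : Prop :=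
  forall (A B : algebra S) (h : A -> B), is_hom h ->
  forall v : X -> A, h (t A v) = t B (h \o v).

(** Birkhoff's preservation of identities.  Commuting with homomorphisms is
    exactly what each closure condition asks for: valuations lift along
    surjections, and the inclusion of a subalgebra and the projections of a
    product are (jointly) injective homomorphisms. *)
Lemma natural_op_eq_variety_gen (S : signature) (X : Type)
    (s t : forall D : algebra S, (X -> D) -> D) (B D : algebra S) :
  natural_op s -> natural_op t -> variety_gen B D ->
  s B =1 t B -> s D =1 t D.
Proof.
move=> nat_s nat_t genD eqB.
apply: (genD (fun D => s D =1 t D)) => // {D genD B eqB}.
split=> [A B h eqA hom_h surj_h v|A P clP eqA v|I A eqA v].
- have [u hu] := functional_choice (fun x a => h a = v x) (fun x => surj_h (v x)).
  have -> : v = h \o u by apply: functional_extensionality => x /=; rewrite hu.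
  by rewrite -nat_s // -nat_t // eqA.
- have hom_val : @is_hom S (subalgebra clP) A (@proj1_sig _ _) by [].
  apply: eq_sig_hprop; first by move=> x; apply: proof_irrelevance.
  by rewrite (nat_s _ _ _ hom_val) (nat_t _ _ _ hom_val) eqA.
- apply: functional_extensionality_dep => j.
  have hom_j : @is_hom S (product A) (A j) (fun a => a j) by [].
  by rewrite (nat_s _ _ _ hom_j) (nat_t _ _ _ hom_j) eqA.
Qed.

Definition reduct (D : algebra ha_sig) : algebra br_sig :=
  @Algebra br_sig D (fun f => @interp ha_sig D (Some f)).

(** The algebras whose reduct lies in a given variety form a variety, so that
    the Heyting case reduces to the operations of Brouwerian algebras. *)
Lemma variety_gen_reduct (L : heyting) (D : algebra ha_sig) :
  variety_gen (ha_alg L) D -> variety_gen (br_alg L) (reduct D).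
Proof.
move=> genD K varK KL; apply: (genD (fun D => K (reduct D))) => // {D genD}.
split=> [A B h KA hom_h surj_h|A P clP KA|I A KA].
- apply: (variety_H (A := reduct A) (B := reduct B) varK KA _ surj_h) => f v.
  exact: (hom_h (Some f)).
- exact: (variety_S (A := reduct A) varK (fun f => clP (Some f)) KA).
- exact: (variety_P (A := fun j => reduct (A j)) varK KA).
Qed.

(** * An identity that determines the second element of each level *)

Section Operations.
Variable D : algebra br_sig.
Implicit Types x y : D.

Definition pair_fun x y : 'I_2 -> D := fun i => if i == ord0 then x else y.

Definition imp x y : D := @interp br_sig D Imp (pair_fun x y).
Definition meet x y : D := @interp br_sig D Meet (pair_fun x y).
Definition join x y : D := @interp br_sig D Join (pair_fun x y).

(** In a chain this is the join of [x] and [y].  In general, when it is top, [x <= y]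
    forces [y] to be top and [y <= x] forces [x] to be top. *)
Definition level_term x y : D :=
  meet (imp (imp x y) y) (imp (imp y x) x).

(** The biimplication that stands for [x /\ y = x' \/ y']. *)
Definition link_term x y x' y' : D :=
  meet (imp (meet x y) (join x' y')) (imp (join x' y') (meet x y)).

Definition three_levels (b c : nat -> D) : D :=
  meet (meet (level_term (b 0) (c 0))
             (meet (level_term (b 1) (c 1)) (level_term (b 2) (c 2))))
       (meet (link_term (b 0) (c 0) (b 1) (c 1))
             (link_term (b 1) (c 1) (b 2) (c 2))).

End Operations.

Section HomOperations.
Variables (A B : algebra br_sig) (h : A -> B).
Hypothesis hom_h : is_hom h.

Lemma comp_pair_fun x y : h \o pair_fun x y = pair_fun (h x) (h y).
Proof.
by apply: functional_extensionality => i; rewrite /pair_fun /=; case: ifP.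
Qed.

Lemma hom_imp x y : h (imp x y) = imp (h x) (h y).
Proof. by rewrite /imp hom_h comp_pair_fun. Qed.

Lemma hom_meet x y : h (meet x y) = meet (h x) (h y).
Proof. by rewrite /meet hom_h comp_pair_fun. Qed.

Lemma hom_join x y : h (join x y) = join (h x) (h y).
Proof. by rewrite /join hom_h comp_pair_fun. Qed.

Lemma hom_three_levels b c :
  h (three_levels b c) = three_levels (h \o b) (h \o c).
Proof.
by rewrite /three_levels /level_term /link_term !(hom_meet, hom_imp, hom_join).
Qed.

End HomOperations.

Definition incomparable (L : brouwerian) (x y : L) : Prop :=
  ~ br_le x y /\ ~ br_le y x.

(** The property from which the identity follows.  An element of [diamonds] is
    incomparable with another only if the two are [b_ i] and [c_ i], for some [i];
    a new least element is comparable with everything. *)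
Definition unique_incomparable (L : brouwerian) : Prop :=
  forall x y z : L, incomparable x y -> incomparable x z -> y = z.

Section Uniqueness.
Variable L : brouwerian.
Hypothesis uniL : unique_incomparable L.
Implicit Types e x y b c : L.

Notation "x <=' y" := (br_le x y) (at level 70).
Notation "x /\' y" := (br_meet x y) (at level 40).
Notation "x \/' y" := (br_join x y) (at level 50).

Lemma br_meet_lel x y : x /\' y <=' x.
Proof. by case: (proj1 (br_meetP x y _) (br_le_refl _)). Qed.

Lemma br_meet_ler x y : x /\' y <=' y.
Proof. by case: (proj1 (br_meetP x y _) (br_le_refl _)). Qed.

Lemma br_join_gel x y : x <=' x \/' y.
Proof. by case: (proj1 (br_joinP x y _) (br_le_refl _)). Qed.

Lemma br_join_ger x y : y <=' x \/' y.
Proof. by case: (proj1 (br_joinP x y _) (br_le_refl _)). Qed.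

Lemma br_imp_elim z x y : z <=' br_imp x y -> z <=' x -> z <=' y.
Proof.
move=> zxy zx; apply: (br_le_trans _ (proj2 (br_impP z x y) zxy)).
by apply/br_meetP; split=> //; apply: br_le_refl.
Qed.

Lemma br_meet_idl x y : x <=' y -> y /\' x = x.
Proof.
move=> xy; apply: br_le_anti; first exact: br_meet_ler.
by apply/br_meetP; split=> //; apply: br_le_refl.
Qed.

Lemma br_join_idl x y : y <=' x -> x \/' y = x.
Proof.
move=> xy; apply: br_le_anti; last exact: br_join_gel.
by apply/br_joinP; split=> //; apply: br_le_refl.
Qed.

(** The consequence of [e <= level_term x y] that the argument uses, for [x] and [y]
    in the algebra of elements below [e]. *)
Record level e x y : Prop := Level {
  level_lel : x <=' e;
  level_ler : y <=' e;
  level_topr : x <=' y -> y = e;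
  level_topl : y <=' x -> x = e
}.

Lemma levelP e x y : level e x y -> [\/ x = e, y = e | incomparable x y].
Proof.
case=> _ _ xy yx; have [/xy|nxy] := classic (x <=' y); first exact: Or32.
by have [/yx|nyx] := classic (y <=' x); [apply: Or31 | apply: Or33].
Qed.

(** If [b0] is incomparable with [c0], then it cannot form a linked level with [e]
    as well: that would give [b0 = b1 \/ c1'] for some [c1'] forming a
    level with [b1].  As [b1 \/ c1] lies below [b0 /\ c0], neither [b1] nor [c1] is
    [e], so [b1] is incomparable with [c1].  Hence [c1'] is [e], making [b0]
    comparable with [c0], or it is [c1], making [b0] equal to [b0 /\ c0]. *)
Lemma no_mixed_levels e b0 c0 b1 c1 c1' :
  level e b0 c0 -> level e b1 c1 -> level e b1 c1' -> incomparable b0 c0 ->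
  b0 /\' c0 = b1 \/' c1 -> b0 <> b1 \/' c1'.
Proof.
move=> l0 l1 l1' [nbc ncb] link eb0.
have ltop z : z = e -> ~ z <=' b0 /\' c0.
  move=> -> le; apply: nbc; apply: br_le_trans (level_lel l0) _.
  exact: br_le_trans le (br_meet_ler _ _).
have b1e : b1 <> e by move/ltop; rewrite link => /(_ (br_join_gel _ _)).
have [//||inc1] := levelP l1.
  by move/ltop; rewrite link => /(_ (br_join_ger _ _)).
have [//|c1'e|inc1'] := levelP l1'.
  apply: ncb; rewrite eb0 c1'e; apply: br_le_trans (level_ler l0) _.
  exact: br_join_ger.
apply: nbc; rewrite eb0 -(uniL inc1 inc1') -link; exact: br_meet_ler.
Qed.

(** As [b0 <> e], each of [c0], [c0'] is [e] or the one element incomparable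
    with [b0].
    If only one of them is [e], the link at that one reads [b0 = b1 \/ _], which
    [no_mixed_levels] excludes. *)
Lemma partner_unique e b0 c0 c0' b1 c1 c1' :
  level e b0 c0 -> level e b0 c0' -> level e b1 c1 -> level e b1 c1' ->
  b0 /\' c0 = b1 \/' c1 -> b0 /\' c0' = b1 \/' c1' ->
  b0 <> e -> c0 = c0'.
Proof.
have le_self c : c = e -> level e b0 c -> b0 /\' c = b0.
  move=> -> l; apply: br_le_anti; first exact: br_meet_lel.
  by apply/br_meetP; split; [apply: br_le_refl | apply: level_lel l].
move=> l0 l0' l1 l1' link link' nb0.
have [//|c0e|inc] := levelP l0; have [//|c0e'|inc'] := levelP l0'.
- by rewrite c0e.
- by case: (no_mixed_levels l0' l1' l1 inc' link'); rewrite -link le_self.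
- by case: (no_mixed_levels l0 l1 l1' inc link); rewrite -link' le_self.
- exact: uniL inc inc'.
Qed.

(** When [b0 = e], the links express [c0] and [c0'] by the next level, where
    either [b1 = e] makes both of them [e] or [partner_unique] applies; this is
    why three levels are taken. *)
Lemma partner_unique2 e b0 c0 c0' b1 c1 c1' b2 c2 c2' :
  level e b0 c0 -> level e b0 c0' -> level e b1 c1 -> level e b1 c1' ->
  level e b2 c2 -> level e b2 c2' ->
  b0 /\' c0 = b1 \/' c1 -> b0 /\' c0' = b1 \/' c1' ->
  b1 /\' c1 = b2 \/' c2 -> b1 /\' c1' = b2 \/' c2' ->
  c0 = c0'.
Proof.
move=> l0 l0' l1 l1' l2 l2' k0 k0' k1 k1'.
have [b0e|nb0] := classic (b0 = e); last exact: partner_unique k0 k0' nb0.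
move: k0 k0'; rewrite b0e.
rewrite (br_meet_idl (level_ler l0)) (br_meet_idl (level_ler l0')) => -> ->.
have [b1e|nb1] := classic (b1 = e); last first.
  by rewrite (partner_unique l1 l1' l2 l2' k1 k1' nb1).
rewrite b1e (br_join_idl (level_ler l1)).
by rewrite (br_join_idl (level_ler l1')).
Qed.

Lemma level_of_term e x y :
  e <=' level_term (D := br_alg L) x y -> level e (e /\' x) (e /\' y).
Proof.
have half u v : e <=' br_imp (br_imp u v) v ->
    e /\' u <=' e /\' v -> e /\' v = e.
  move=> euv leuv; apply: br_le_anti; first exact: br_meet_lel.
  apply/br_meetP; split; first exact: br_le_refl.
  apply: br_imp_elim euv _; apply/br_impP; apply: br_le_trans leuv _.
  exact: br_meet_ler.
move=> /br_meetP [exy eyx].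
split; [exact: br_meet_lel|exact: br_meet_lel|exact: half exy|exact: half eyx].
Qed.

Lemma link_of_term e x y x' y' :
  e <=' link_term (D := br_alg L) x y x' y' ->
  (e /\' x) /\' (e /\' y) = (e /\' x') \/' (e /\' y').
Proof.
move=> /br_meetP [/= /br_impP down /br_impP up]; apply: br_le_anti.
  have distr : e /\' (x' \/' y') <=' (e /\' x') \/' (e /\' y').
    have comm (u v : L) : u /\' v <=' v /\' u.
      by apply/br_meetP; split; [apply: br_meet_ler | apply: br_meet_lel].
    apply: br_le_trans (comm _ _) _; apply/br_impP; apply/br_joinP.
    by split; apply/br_impP; apply: br_le_trans (comm _ _) _;
      [apply: br_join_gel | apply: br_join_ger].
  apply: br_le_trans distr; apply/br_meetP; split.
    exact: br_le_trans (br_meet_lel _ _) (br_meet_lel _ _).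
  apply: br_le_trans down; apply/br_meetP; split.
    exact: br_le_trans (br_meet_lel _ _) (br_meet_lel _ _).
  by apply/br_meetP; split;
    [apply: br_le_trans (br_meet_lel _ _) (br_meet_ler _ _)
    |apply: br_le_trans (br_meet_ler _ _) (br_meet_ler _ _)].
have part z : z <=' x' \/' y' -> e /\' z <=' (e /\' x) /\' (e /\' y).
  move=> lez.
  have lexy : e /\' z <=' x /\' y.
    apply: br_le_trans up; apply/br_meetP; split; first exact: br_meet_lel.
    exact: br_le_trans (br_meet_ler _ _) lez.
  apply/br_meetP; split; apply/br_meetP; split; do ?exact: br_meet_lel.
    exact: br_le_trans lexy (br_meet_lel _ _).
  exact: br_le_trans lexy (br_meet_ler _ _).
by apply/br_joinP; split; apply: part; [apply: br_join_gel|apply: br_join_ger].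
Qed.

(** The terms in [e] hold modulo the principal filter of [e], so that truncating
    everything by [e] yields three linked levels. *)
Lemma three_levels_identity (b c c' : nat -> br_alg L) :
  let e := meet (three_levels b c) (three_levels b c') in
  meet e (c 0) = meet e (c' 0).
Proof.
move=> e.
have split_levels (c1 : nat -> br_alg L) : e <=' three_levels b c1 ->
    [/\ level e (e /\' b 0) (e /\' c1 0),
        level e (e /\' b 1) (e /\' c1 1),
        level e (e /\' b 2) (e /\' c1 2),
        (e /\' b 0) /\' (e /\' c1 0) = (e /\' b 1) \/' (e /\' c1 1) &
        (e /\' b 1) /\' (e /\' c1 1) = (e /\' b 2) \/' (e /\' c1 2)].
  move=> /br_meetP [/= /br_meetP [/= l0 /br_meetP [/= l1 l2]]].
  move=> /br_meetP [/= k0 k1].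
  by split; [apply: level_of_term|apply: level_of_term|apply: level_of_term
            |apply: link_of_term|apply: link_of_term].
have [l0 l1 l2 k0 k1] := split_levels c (br_meet_lel _ _).
have [l0' l1' l2' k0' k1'] := split_levels c' (br_meet_ler _ _).
exact: partner_unique2 l0 l0' l1 l1' l2 l2' k0 k0' k1 k1'.
Qed.

Lemma three_levels_identity_variety (D : algebra br_sig) :
  variety_gen (br_alg L) D ->
  forall b c c' : nat -> D,
  let e := meet (three_levels b c) (three_levels b c') in
  meet e (c 0) = meet e (c' 0).
Proof.
pose b (D : algebra br_sig) (v : option bool * nat -> D) i := v (None, i).
pose c (D : algebra br_sig) (v : option bool * nat -> D) k i := v (Some k, i).
(* The Boolean [k] selects whether [c] or [c'] stands on the right of the meet. *)
pose t k (D : algebra br_sig) (v : option bool * nat -> D) :=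
  meet (meet (three_levels (b D v) (c D v true))
             (three_levels (b D v) (c D v false))) (c D v k 0).
have nat_t k : natural_op (t k).
  by move=> A B h hom_h v; rewrite /t !(hom_meet hom_h, hom_three_levels hom_h).
move=> genD b1 c1 c1'.
pose w (x : option bool * nat) := match x with
  | (None, i) => b1 i | (Some true, i) => c1 i | (Some false, i) => c1' i end.
apply: (natural_op_eq_variety_gen (nat_t true) (nat_t false) genD _ w) => v.
exact: three_levels_identity.
Qed.

End Uniqueness.

(** * The diamonds *)

Lemma diamonds_unique_incomparable : unique_incomparable diamonds.
Proof.
move=> x y z [/= nxy nyx] [/= nxz nzx].
move: nxy nyx nxz nzx; rewrite !elt_leP.
case: x y z => [|i|i|i] [|j|j|j] [|k|k|k]; rewrite /elt_leb //=; try lia;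
  by move=> *; congr (_ _); lia.
Qed.

Lemma add_bot_unique_incomparable (L : brouwerian) :
  unique_incomparable L -> unique_incomparable (add_bot L).
Proof.
move=> uniL [x|] [y|] [z|] [/= xy yx] [/= xz zx] //; try tauto.
by rewrite (uniL x y z).
Qed.

Lemma three_levels_diamonds k :
  three_levels (D := br_alg diamonds) (fun i => b_ (k + i)) (fun i => c_ (k + i))
  = top_.
Proof.
have elt_impxx x : elt_imp x x = top_ by rewrite /elt_imp elt_leb_refl.
have imp_bc i : elt_imp (b_ i) (c_ i) = c_ i.
  by rewrite /elt_imp /elt_leb /= ltnn.
have imp_cb i : elt_imp (c_ i) (b_ i) = b_ i.
  by rewrite /elt_imp /elt_leb /= ltnn.
have lev i : level_term (D := br_alg diamonds) (b_ i) (c_ i) = top_.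
  rewrite /level_term /meet /imp /= /pair_fun /=.
  by rewrite imp_bc imp_cb !elt_impxx.
have lnk i : link_term (D := br_alg diamonds) (b_ i) (c_ i) (b_ i.+1) (c_ i.+1)
    = top_.
  rewrite /link_term /meet /join /imp /= /pair_fun /=.
  rewrite /elt_meet /elt_join /elt_leb /= !ltnn.
  by rewrite !elt_impxx.
by rewrite /three_levels !addnS addn0 !lev !lnk.
Qed.

(** Applied to the images of the levels from [k] on, the identity equates
    [f (c_ k)] and [g (c_ k)], because its premises are the images of [top_] under
    [f] and under [g].  The generator [L] is [diamonds] itself, or [add_bot diamonds]
    when [f] and [g] are restrictions of homomorphisms of Heyting algebras. *)
Lemma homs_from_diamonds_eq (L : brouwerian) (D : algebra br_sig)
    (f g : br_alg diamonds -> D) :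
  unique_incomparable L -> variety_gen (br_alg L) D -> is_hom f -> is_hom g ->
  (forall i, f (b_ i) = g (b_ i)) -> f =1 g.
Proof.
move=> uniL genD hom_f hom_g fgb.
have fgtop : f top_ = g top_.
  have -> : top_ = @interp br_sig (br_alg diamonds) Top (fun=> top_) by [].
  rewrite hom_f hom_g; congr (interp _).
  by apply: functional_extensionality => -[].
have meet_top (x : br_alg diamonds) :
    meet (meet (top_ : br_alg diamonds) top_) x = x.
  by case: x => [|i|i|i]; rewrite /meet /= /pair_fun /= /elt_meet /elt_leb.
have fgc k : f (c_ k) = g (c_ k).
  pose b i := b_ (k + i); pose c i := c_ (k + i).
  have topf : three_levels (f \o b) (f \o c) = f top_.
    by rewrite -(hom_three_levels hom_f) three_levels_diamonds.
  have topg : three_levels (f \o b) (g \o c) = g top_.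
    have -> : f \o b = g \o b.
      by apply: functional_extensionality => i; apply: fgb.
    by rewrite -(hom_three_levels hom_g) three_levels_diamonds.
  have := three_levels_identity_variety uniL genD (f \o b) (f \o c) (g \o c).
  rewrite topf topg /= -{1}fgtop {3}fgtop -!(hom_meet hom_f) -!(hom_meet hom_g).
  by rewrite !meet_top /c addn0.
have fgd k : f (d_ k) = g (d_ k).
  have -> : d_ k = join (b_ k : br_alg diamonds) (c_ k).
    by rewrite /join /= /pair_fun /= /elt_join /elt_leb /= ltnn.
  by rewrite (hom_join hom_f) (hom_join hom_g) fgb fgc.
by case.
Qed.

Definition in_chain (x : elt) : Prop := x = top_ \/ exists i, x = b_ i.

Lemma in_chain_total x y :
  in_chain x -> in_chain y -> elt_leb x y \/ elt_leb y x.
Proof.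
by case=> [->|[i ->]] [->|[j ->]]; rewrite /elt_leb /=; lia.
Qed.

(** Implication stays in the chain because [elt_imp x y] departs from [top_] and
    [y] only when [y] is some [d_ j]. *)
Lemma in_chain_ops x y : in_chain x -> in_chain y ->
  [/\ in_chain (elt_imp x y), in_chain (elt_meet x y) & in_chain (elt_join x y)].
Proof.
move=> cx cy; have := in_chain_total cx cy.
rewrite /elt_meet /elt_join /elt_imp.
case: ifP => [_ _|nxy]; first by split=> //; left.
case: ifP => [_ _|nyx []] //; split=> //.
case: cx => [->|[i ->]] //; case: cy => [->|[j ->]]; first by left.
by right; exists j.
Qed.

Lemma in_chain_closed : @is_subuniverse br_sig (br_alg diamonds) in_chain.
Proof.
case=> v vC /=; last by left.
all: by have [] := in_chain_ops (vC ord0) (vC ord_max).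
Qed.

Definition in_chain_bot (x : option elt) : Prop :=
  if x is Some a then in_chain a else True.

Lemma in_chain_bot_closed :
  @is_subuniverse ha_sig (ha_alg (add_bot diamonds)) in_chain_bot.
Proof.
case=> [[]|//] v vC /=; last by left.
all: move: (vC ord0) (vC ord_max).
all: case: (v ord0) (v ord_max) => [x|] [y|] //= cx cy; try by left.
all: by have [] := in_chain_ops cx cy.
Qed.

Lemma not_ES_subalgebra (S : signature) (B : algebra S) (P : B -> Prop)
    (clP : is_subuniverse P) (x : B) :
  ~ P x -> is_epi (variety_gen B) (A := subalgebra clP) (@proj1_sig _ P) ->
  ~ ES_property (variety_gen B).
Proof.
move=> nPx epi ES.
have genB : variety_gen B B by [].
have genP : variety_gen B (subalgebra clP).
  by move=> K varK KB; apply: variety_S.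
have [] := ES _ _ _ genP genB _ epi x; first by [].
by case=> y Py /= eyx; apply: nPx; rewrite -eyx.
Qed.

Theorem theorem6p1 :
  ~ ES_property (variety_gen (br_alg diamonds)) /\
  ~ ES_property (variety_gen (ha_alg (add_bot diamonds))).
Proof.
have c0_notin : ~ in_chain (c_ 0) by case=> [|[i]].
have b_in i : in_chain (b_ i) by right; exists i.
split.
  apply: (not_ES_subalgebra (clP := in_chain_closed) c0_notin).
  move=> D f g genD hom_f hom_g fg.
  apply: (homs_from_diamonds_eq diamonds_unique_incomparable genD) => // i.
  exact: (fg (exist _ (b_ i) (b_in i))).
apply: (not_ES_subalgebra (clP := in_chain_bot_closed) (x := Some (c_ 0))) => //.
move=> D f g genD hom_f hom_g fg.
have hom_Some (h : ha_alg (add_bot diamonds) -> D) : is_hom h ->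
    @is_hom br_sig (br_alg diamonds) (reduct D) (h \o Some).
  by move=> hom_h [] v; apply: (hom_h (Some _) (Some \o v)).
have fgS := homs_from_diamonds_eq
  (add_bot_unique_incomparable diamonds_unique_incomparable)
  (variety_gen_reduct genD) (hom_Some f hom_f) (hom_Some g hom_g).
case=> [x|].
  by apply: fgS => i; apply: (fg (exist _ (Some (b_ i)) (b_in i))).
have -> : None = @interp ha_sig (ha_alg (add_bot diamonds)) None (fun=> None) by [].
rewrite hom_f hom_g; congr (interp _).
by apply: functional_extensionality => -[].
Qed.
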